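(* Let $m\geq 1$ be an integer and let $U$ be the incidence matrix of a symmetric $2$-$(4m-1,2m-1,m-1)$ design (Hadamard design). Let \[a=-1+\frac{1}{2m}\pm\mathbf{i}\frac{\sqrt{4m-1}}{2m}\] (either choice of sign). Then the matrix obtained from $U$ by replacing every entry $0$ with $a$ is a complex Hadamard matrix of order $4m-1$.
   Context: A complex Hadamard matrix of order $n$ is an $n\times n$ matrix $H$ with unimodular complex entries satisfying $HH^\ast=nI$. The incidence matrix of a symmetric $2$-$(v,k,\lambda)$ design is a $v\times v$ $0$-$1$ matrix $B$ with exactly $k$ ones in every row and column satisfying $BB^{T}=(k-\lambda)I+\lambda J$, $J$ the all-ones matrix. *)

(* Defs.v *)
From HB Require Import structures.
From mathcomp Require Import all_boot all_order all_algebra.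
From mathcomp Require Import sesquilinear spectral.
From mathcomp Require Import complex reals.

Set Implicit Arguments.
Unset Strict Implicit.
Unset Printing Implicit Defensive.

Import Order.TTheory GRing.Theory Num.Theory.

Local Open Scope ring_scope.
Local Open Scope sesquilinear_scope.

Definition complex_hadamard (R : realType) (n : nat) (H : 'M[R[i]]_n) : Prop :=
  (forall i j, `|H i j| = 1) /\ H *m H^t* = n%:R%:M.

(* The entries live in a numDomainType, hence in characteristic 0, so that the
   equation for [B *m B^T] is as strong as the corresponding one over the
   integers.  The difference [k%:R - l%:R] is taken in the ring, not in [nat]. *)
Definition symmetric_design_incidence (F : numDomainType) (v k l : nat)
    (B : 'M[F]_v) : Prop :=
  [/\ forall i j, B i j = 0 \/ B i j = 1,
      forall i, #|[set j | B i j == 1]| = k,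
      forall j, #|[set i | B i j == 1]| = k
    & B *m B^T = (k%:R - l%:R)%:M + l%:R *: const_mx 1].

(* Main.v *)
(** With [J] the all-ones matrix, the substituted matrix is [H = a J + (1 - a) U],
    so when [|a| = 1] the off-diagonal entries of [H H^*] all equal
    [v - (2 - a - a^* ) (k - l)].  For the parameters of a Hadamard design
    [k - l = m], and the two given values of [a] are exactly the unimodular
    numbers with [2 - a - a^* = (4 m - 1) / m]. *)
Require Import Defs.
From mathcomp Require Import all_boot all_order all_algebra.
From mathcomp Require Import sesquilinear.
From mathcomp Require Import complex reals.
From mathcomp Require Import ring lra zify.

Import GRing.Theory Num.Theory.
Local Open Scope ring_scope.

Section SubstitutedDesign.
Local Open Scope sesquilinear_scope.

Lemma sum_indicator (S : nzSemiRingType) (T : finType) (f : T -> S) :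
  (forall t, f t = 0 \/ f t = 1) -> \sum_t f t = #|[set t | f t == 1]|%:R.
Proof.
move=> f01; rewrite -sum1_card natr_sum [RHS]big_mkcond /=.
apply: eq_bigr => t _; rewrite inE.
by case: (f01 t) => ->; rewrite ?eqxx // eq_sym oner_eq0.
Qed.

(** Since the entries of [H] are affine in those of [B], the product depends only on row sums and
    inner products of rows of [B]. *)
Lemma design_subst_unitary (C : numClosedFieldType) (v k l : nat)
    (B : 'M[C]_v) (a : C) :
  symmetric_design_incidence k l B -> `|a| = 1 ->
  (2 - a - a^*) * (k%:R - l%:R) = v%:R ->
  let H := map_mx (fun z => if z == 0 then a else z) B in
  H *m H^t* = v%:R%:M.
Proof.
move=> [B01 rowB _ BBT] norm_a av /=.
have a1 : a * a^* = 1 by rewrite -normCK norm_a expr1n.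
have HE i j : (if B i j == 0 then a else B i j) = a + (1 - a) * B i j.
  by case: (B01 i j) => ->; rewrite ?eqxx ?oner_eq0; ring.
have conjB i j : (B i j)^* = B i j.
  by case: (B01 i j) => ->; rewrite ?conjC0 ?conjC1.
have sumB i : \sum_j B i j = k%:R.
  by rewrite sum_indicator // rowB.
have gramB i j : \sum_t B i t * B j t = (k%:R - l%:R) *+ (i == j) + l%:R.
  move/matrixP: BBT => /(_ i j); rewrite !mxE mulr1 => <-.
  by apply: eq_bigr => t _; rewrite mxE.
apply/matrixP => i j; rewrite !mxE.
transitivity (\sum_t (a * a^* + a * (1 - a^*) * B j t
    + (1 - a) * a^* * B i t + (1 - a) * (1 - a^*) * (B i t * B j t))).
  apply: eq_bigr => t _; rewrite !mxE !HE.
  rewrite rmorphD rmorphM rmorphB rmorph1 /= conjB /=; ring.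
rewrite !big_split /= -!mulr_sumr !sumB gramB sumr_const card_ord (mulrnAr a) a1.
rewrite -av; case: eqP => _; rewrite ?mulr1n ?mulr0n; ring: a1 av.
Qed.

End SubstitutedDesign.

Local Open Scope complex_scope.

Theorem theorem1 (R : realType) (m : nat) (U : 'M[R[i]]_(4 * m - 1)) (a : R[i]) :
  (1 <= m)%N ->
  symmetric_design_incidence (2 * m - 1) (m - 1) U ->
  a = (-1 + 1 / (2 * m%:R)) +i* (Num.sqrt (4 * m%:R - 1) / (2 * m%:R)) \/
  a = (-1 + 1 / (2 * m%:R)) -i* (Num.sqrt (4 * m%:R - 1) / (2 * m%:R)) ->
  complex_hadamard (map_mx (fun z => if z == 0 then a else z) U).
Proof.
move=> m_gt0 designU aE.
have m1 : 1 <= m%:R :> R by rewrite ler1n.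
have m0 : m%:R != 0 :> R by rewrite pnatr_eq0 -lt0n.
(* For [m >= 1] no subtraction in the parameters is truncated. *)
have vE : (4 * m - 1)%:R = 4 * m%:R - 1 :> R.
  by rewrite natrB ?natrM //; lia.
have klE : (2 * m - 1)%:R - (m - 1)%:R = m%:R :> R[i].
  by rewrite !natrB ?natrM //; [ring | lia].
(* Only the real part and the squared imaginary part of [a] matter, so both signs are handled at
   once. *)
have ReaE : complex.Re a = -1 + 1 / (2 * m%:R) by case: aE => ->.
have ImaE : complex.Im a ^+ 2 = (4 * m%:R - 1) / (2 * m%:R) ^+ 2.
  have sqr_sqrt : Num.sqrt (4 * m%:R - 1) ^+ 2 = 4 * m%:R - 1 :> R.
    by rewrite sqr_sqrtr //; lra.
  by case: aE => -> /=; rewrite ?sqrrN expr_div_n sqr_sqrt.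
have norm_a : `|a| = 1.
  (* This is [(2m - 1)^2 + (4m - 1) = (2m)^2], divided by [(2m)^2]. *)
  rewrite normc_def ReaE ImaE (_ : _ + _ = 1) ?sqrtr1 //.
  by field.
split=> [i j|].
  rewrite mxE; case: designU => U01 _ _ _.
  by case: (U01 i j) => ->; rewrite ?eqxx // oner_eq0 normr1.
apply: design_subst_unitary designU norm_a _.
rewrite klE.
have trace_a : a + a^* = (complex.Re a *+ 2)%:C.
  by case: (a) => x y /=; rewrite /GRing.add /= subrr.
rewrite -addrA -opprD [X in 2 - X]trace_a ReaE.
(* All terms are real, so the claim descends to [R] as [(4 - 1/m) * m = 4m - 1]. *)
have natC n : n%:R = n%:R%:C :> R[i] by rewrite rmorph_nat.
by rewrite !natC -rmorphB -rmorphM vE; congr (_%:C); field.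
Qed.
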